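(* Let $d\geq 2$ be an integer, let $m^{(d)}_{k,n}$ ($k\in\mathbb{Z}$, $n\in\mathbb{Z}_{\geq 0}$) be the entries of the Motzkin triangle of order $d$, and for $k\geq 1$ let $\mathbf{\underline{k}}$ denote the $k$-dimensional irreducible representation of $sl_2$. Then for every $n\geq 0$, as representations of $sl_2$, $$(\mathbf{\underline{d-1}}\oplus\mathbf{\underline{d}})^{\otimes n}\cong\bigoplus_{k>0} m^{(d)}_{k,n}\,\mathbf{\underline{k}} ,$$ where $m^{(d)}_{k,n}\,\mathbf{\underline{k}}$ denotes the direct sum of $m^{(d)}_{k,n}$ copies of $\mathbf{\underline{k}}$; that is, for $k>0$, $m^{(d)}_{k,n}$ is the multiplicity of $\mathbf{\underline{k}}$ in $(\mathbf{\underline{d-1}}\oplus\mathbf{\underline{d}})^{\otimes n}$.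
   Context: $sl_2$ is the Lie algebra of traceless $2\times 2$ complex matrices, and $\mathbf{\underline{k}}$ ($k\geq 1$) is its unique (up to isomorphism) irreducible representation of dimension $k$ (so $\mathbf{\underline{d-1}}$ has dimension $d-1$); $\mathbf{\underline{1}}$ is the trivial representation, and the zeroth tensor power is $\mathbf{\underline{1}}$. For $d\geq 2$, the Motzkin triangle of order $d$ is the family of integers $m^{(d)}_{k,n}$ ($k\in\mathbb{Z}$, $n\in\mathbb{Z}_{\geq0}$) defined by $m^{(d)}_{-1,0}=-1$, $m_{1,0}^{(d)}=1$, $m_{i,0}^{(d)}=0$ for all $i\neq-1,1$, and the recurrence $$m_{k,n+1}^{(d)}=m_{k-(d-1),n}^{(d)}+m_{k-(d-2),n}^{(d)}+\dots+m_{k+d-2,n}^{(d)}+m_{k+d-1,n}^{(d)}$$ (a sum of $2d-1$ terms, with first indices in steps of $1$). *)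

(* Defs.v *)
From HB Require Import structures.
From mathcomp Require Import all_boot all_order all_algebra.
From mathcomp Require Import ring.
From mathcomp Require Import mxtens.

Set Implicit Arguments.
Unset Strict Implicit.
Unset Printing Implicit Defensive.

Import GRing.Theory.
Local Open Scope ring_scope.

Section Sl2.
Variable F : fieldType.

Definition traceless : {pred 'M[F]_2} := fun A => \tr A == 0.

Fact traceless_submod_closed : submod_closed traceless.
Proof.
split=> [|a A B /eqP trA /eqP trB]; apply/eqP; first exact: mxtrace0.
by rewrite mxtraceD mxtraceZ trA trB mulr0 addr0.
Qed.

HB.instance Definition _ :=
  GRing.isSubmodClosed.Build F 'M[F]_2 traceless traceless_submod_closed.

Record sl2 := Sl2 { sl2mx :> 'M[F]_2; sl2mxP : sl2mx \in traceless }.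

HB.instance Definition _ := [isSub for sl2mx].
HB.instance Definition _ := [Choice of sl2 by <:].
HB.instance Definition _ := [SubChoice_isSubLmodule of sl2 by <:].

Fact bracket_traceless (x y : sl2) : x *m y - y *m x \in traceless.
Proof. by apply/eqP; rewrite raddfB /= mxtrace_mulC subrr. Qed.

Definition bracket (x y : sl2) : sl2 := Sl2 (bracket_traceless x y).

(* A finite-dimensional representation, on column vectors: x acts on         *)
(* v : 'cV_(rdim V) by v |-> V x *m v.                                        *)
Record rep := Rep {
  rdim : nat;
  ract :> sl2 -> 'M[F]_rdim;
  ract_linear : linear ract;
  ract_bracket : forall x y,
    ract (bracket x y) = ract x *m ract y - ract y *m ract x }.

Definition rep_iso (V W : rep) : Prop :=
  exists f : {linear 'cV[F]_(rdim V) -> 'cV[F]_(rdim W)},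
    bijective f /\ forall x v, f (V x *m v) = W x *m f v.

Definition invariant (V : rep) (U : {vspace 'cV[F]_(rdim V)}) : Prop :=
  forall x v, v \in U -> V x *m v \in U.

Definition irreducible (V : rep) : Prop :=
  (0 < rdim V)%N /\
  forall U : {vspace 'cV[F]_(rdim V)},
    invariant U -> U = 0%VS \/ U = fullv.

Fact triv_linear n : linear (fun _ : sl2 => 0 : 'M[F]_n).
Proof. by move=> a x y; rewrite scaler0 addr0. Qed.

Fact triv_bracket n (x y : sl2) : 
  0 = (0 : 'M_n) *m 0 - (0 : 'M_n) *m 0 :> 'M[F]_n.
Proof. by rewrite mulmx0 subrr. Qed.

Definition rep_zero : rep := Rep (triv_linear 0) (@triv_bracket 0).
Definition rep_triv : rep := Rep (triv_linear 1) (@triv_bracket 1).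

Section Operations.
Variables V W : rep.

Definition dsum_act (x : sl2) : 'M[F]_(rdim V + rdim W) :=
  block_mx (V x) 0 0 (W x).

Fact dsum_linear : linear dsum_act.
Proof.
move=> a x y; rewrite /dsum_act !ract_linear.
by rewrite scale_block_mx add_block_mx !scaler0 !addr0.
Qed.

Fact dsum_bracket x y :
  dsum_act (bracket x y) = dsum_act x *m dsum_act y - dsum_act y *m dsum_act x.
Proof.
rewrite /dsum_act !ract_bracket !mulmx_block opp_block_mx add_block_mx.
by rewrite !mulmx0 !mul0mx !addr0 !add0r !oppr0.
Qed.

Definition dsum : rep := Rep dsum_linear dsum_bracket.

Definition tens_act (x : sl2) : 'M[F]_(rdim V * rdim W) :=
  V x *t 1%:M + 1%:M *t W x.

Fact tens_linear : linear tens_act.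
Proof.
move=> a x y; rewrite /tens_act !ract_linear; apply/matrixP=> i j.
by rewrite !mxE mulrDl mulrDr mulrDr !mulrA (mulrC _ a) addrACA -mulrA.
Qed.

Fact tens_bracket x y :
  tens_act (bracket x y) = tens_act x *m tens_act y - tens_act y *m tens_act x.
Proof.
rewrite /tens_act !ract_bracket !mulmxDl !mulmxDr !tensmx_mul !mulmx1 !mul1mx.
have -> (A B : 'M[F]_(rdim V)) :
    (A - B) *t (1%:M : 'M[F]_(rdim W)) = A *t 1%:M - B *t 1%:M.
  by apply/matrixP=> i j; rewrite !mxE mulrBl.
have -> (A B : 'M[F]_(rdim W)) :
    (1%:M : 'M[F]_(rdim V)) *t (A - B) = 1%:M *t A - 1%:M *t B.
  by apply/matrixP=> i j; rewrite !mxE mulrBr.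
apply/matrixP=> i j; move: (V x *t W y) (V y *t W x) => a b.
rewrite !mxE; ring.
Qed.

Definition tens : rep := Rep tens_linear tens_bracket.
End Operations.

Definition copies (m : nat) (V : rep) : rep := iter m (dsum V) rep_zero.
Definition tens_pow (V : rep) (n : nat) : rep := iter n (tens V) rep_triv.

End Sl2.

Fixpoint motzkin (d : nat) (k : int) (n : nat) : int :=
  if n is n'.+1 then
    \sum_(i < (2 * d).-1) motzkin d (k - d.-1%:Z + i%:Z) n'
  else if k == -1 then -1 else if k == 1 then 1 else 0.

(* Main.v *)
Require Import Defs.
From HB Require Import structures.
From mathcomp Require Import all_boot all_order all_algebra.
From mathcomp Require Import reals complex.
From mathcomp Require Import mxtens ring zify.

Import GRing.Theory Num.Theory.
Local Open Scope ring_scope.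
Set Implicit Arguments.
Unset Strict Implicit.
Unset Printing Implicit Defensive.

(** Over an algebraically closed field of characteristic 0, the class of a
    representation V of sl_2 is determined by the multiplicities w(j) of the
    eigenvalues (weights) j of h: the irreducible of dimension k occurs
    w(k-1) - w(k+1) times.  The weights of d-1 (+) d are the 2d-1 integers from
    -(d-1) to d-1, each once, and weights add in tensor products; so the weight
    multiplicities of its n-th tensor power count the n-step walks on Z with
    steps in [-(d-1), d-1] (tens_pow_weighted).  They obey the recurrence of the
    Motzkin triangle, and comparing the rows n = 0 shows that
    m_{k,n} = w_n(k-1) - w_n(k+1) (motzkin_walks).  These differences are
    nonnegative because w_n is even and decreases away from 0 (leq_walks).

    The decomposition itself (weighted_decomp) is obtained for any V on which h
    is diagonalizable with integer eigenvalues, by counting dimensions, with no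
    appeal to complete reducibility.  The operator e maps the weight space
    k-1 to the weight space k+1, so its kernel there has dimension at least
    w(k-1) - w(k+1).  Each vector of that kernel is the image of a highest
    weight vector of the irreducible of dimension k (fbasis_hom), because such
    an irreducible is spanned by the vectors f^j v of a highest weight vector v
    (irreducible_fbasis).  Choosing w(k-1) - w(k+1) independent vectors for each
    k gives a morphism from the direct sum of the right irreducibles to V.  It
    is injective: e is nilpotent on the sum, so a nonzero kernel would contain a
    nonzero vector killed by e, that is, a combination of highest weight
    vectors, and those have independent images (embeds_dsum, embeds_inj).
    Finally the sum of k (w(k-1) - w(k+1)) over k telescopes to the sum of w(j)
    over all integers j when w is even, so both sides have the dimension of
    V. *)

(** * The standard basis of sl_2 and highest weight vectors *)
Section Sl2Theory.
Variable F : numClosedFieldType.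
Implicit Types (V W A B : rep F) (a b : F).

Fact sl2e_traceless : (delta_mx 0 1 : 'M[F]_2) \in @traceless F.
Proof. by rewrite unfold_in /mxtrace big_ord_recr big_ord1 !mxE /= addr0. Qed.
Fact sl2f_traceless : (delta_mx 1 0 : 'M[F]_2) \in @traceless F.
Proof. by rewrite unfold_in /mxtrace big_ord_recr big_ord1 !mxE /= addr0. Qed.
Fact sl2h_traceless :
  (delta_mx 0 0 - delta_mx 1 1 : 'M[F]_2) \in @traceless F.
Proof.
by rewrite unfold_in /mxtrace big_ord_recr big_ord1 !mxE /= subr0 sub0r subrr.
Qed.

Definition sl2_e : sl2 F := Sl2 sl2e_traceless.
Definition sl2_f : sl2 F := Sl2 sl2f_traceless.
Definition sl2_h : sl2 F := Sl2 sl2h_traceless.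

Lemma sl2_decomp (x : sl2 F) :
  x = sl2mx x 0 0 *: sl2_h + (sl2mx x 0 1 *: sl2_e + sl2mx x 1 0 *: sl2_f).
Proof.
have tr0 : sl2mx x 1 1 = - sl2mx x 0 0.
  apply/eqP; rewrite -addr_eq0 addrC; have := sl2mxP x.
  rewrite unfold_in /mxtrace big_ord_recl big_ord1.
  by congr (_ + sl2mx x _ _ == 0); apply: val_inj.
have ord2 (i : 'I_2) : i = 0 \/ i = 1.
  by case: i => [[|[|//]] i2]; [left | right]; apply: val_inj.
apply: val_inj; rewrite /=; apply/matrixP => i j.
rewrite !mxE.
by case: (ord2 i) => ->; case: (ord2 j) => ->; rewrite /= ?tr0; ring.
Qed.

Lemma bracket_he : bracket sl2_h sl2_e = 2%:R *: sl2_e.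
Proof.
apply: val_inj; rewrite /= mulmxBl mulmxBr !mul_delta_mx_cond /=.
by rewrite !mulr0n !mulr1n subr0 sub0r opprK scaler_nat mulr2n.
Qed.
Lemma bracket_hf : bracket sl2_h sl2_f = - 2%:R *: sl2_f.
Proof.
apply: val_inj; rewrite /= mulmxBl mulmxBr !mul_delta_mx_cond /=.
by rewrite !mulr0n !mulr1n subr0 sub0r scaleNr scaler_nat mulr2n opprD.
Qed.
Lemma bracket_ef : bracket sl2_e sl2_f = sl2_h.
Proof.
apply: val_inj; rewrite /= !mul_delta_mx_cond /=.
by rewrite !mulr1n.
Qed.

HB.instance Definition _ (V : rep F) :=
  GRing.isLinear.Build F (sl2 F) _ _ V (ract_linear V).

Lemma act_bracket V x y (v : 'cV_(rdim V)) :
  V x *m (V y *m v) = V y *m (V x *m v) + V (bracket x y) *m v.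
Proof. by rewrite ract_bracket mulmxBl !mulmxA addrC subrK. Qed.

Lemma act_he V (v : 'cV_(rdim V)) :
  V sl2_h *m (V sl2_e *m v) = V sl2_e *m (V sl2_h *m v) + 2%:R *: (V sl2_e *m v).
Proof. by rewrite act_bracket bracket_he linearZ /= scalemxAl. Qed.
Lemma act_hf V (v : 'cV_(rdim V)) :
  V sl2_h *m (V sl2_f *m v) = V sl2_f *m (V sl2_h *m v) - 2%:R *: (V sl2_f *m v).
Proof. by rewrite act_bracket bracket_hf linearZ /= -scalemxAl scaleNr. Qed.
Lemma act_ef V (v : 'cV_(rdim V)) :
  V sl2_e *m (V sl2_f *m v) = V sl2_f *m (V sl2_e *m v) + V sl2_h *m v.
Proof. by rewrite act_bracket bracket_ef. Qed.

(** The zero vector is allowed: the vectors with this property for a fixed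
    weight form a subspace. *)
Definition hwv V a (v : 'cV_(rdim V)) := V sl2_e *m v = 0 /\ V sl2_h *m v = a *: v.

Definition fpow V j (v : 'cV_(rdim V)) := iter j (mulmx (V sl2_f)) v.
Definition epow V j (v : 'cV_(rdim V)) := iter j (mulmx (V sl2_e)) v.

Lemma fpowS V j (v : 'cV_(rdim V)) : fpow j.+1 v = V sl2_f *m fpow j v.
Proof. by []. Qed.
Lemma epowS V j (v : 'cV_(rdim V)) : epow j.+1 v = V sl2_e *m epow j v.
Proof. by []. Qed.

Lemma h_fpow V a (v : 'cV_(rdim V)) j :
  V sl2_h *m v = a *: v ->
  V sl2_h *m fpow j v = (a - (2 * j)%:R) *: fpow j v.
Proof.
move=> hv; elim: j => [|j IH]; first by rewrite subr0.
rewrite /= act_hf IH -scalemxAr -scalerBl; congr (_ *: _); ring.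
Qed.

Lemma h_epow V a (v : 'cV_(rdim V)) j :
  V sl2_h *m v = a *: v ->
  V sl2_h *m epow j v = (a + (2 * j)%:R) *: epow j v.
Proof.
move=> hv; elim: j => [|j IH]; first by rewrite addr0.
rewrite /= act_he IH -scalemxAr -scalerDl; congr (_ *: _); ring.
Qed.

(** The coefficient vanishes only when a is the natural number j; this is what
    ties the length of the string v, f v, f^2 v, ... to the weight of v. *)
Lemma e_fpow V a (v : 'cV_(rdim V)) j : hwv a v ->
  V sl2_e *m fpow j.+1 v = (j.+1%:R * (a - j%:R)) *: fpow j v.
Proof.
case=> ev hv; elim: j => [|j IH].
  by rewrite act_ef ev mulmx0 add0r hv mul1r subr0.
rewrite [fpow j.+2 v]fpowS act_ef IH -scalemxAr (h_fpow _ hv) -scalerDl.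
congr (_ *: _); ring.
Qed.

(** Eigenvalues are roots of the characteristic polynomial, of degree n. *)
Lemma eigenvalues_leq n (M : 'M[F]_n) (c : nat -> F) m :
  injective c ->
  (forall i, (i < m)%N -> exists2 v : 'cV_n, v != 0 & M *m v = c i *: v) ->
  (m <= n)%N.
Proof.
move=> c_inj eig.
have pnz : char_poly M != 0 by rewrite monic_neq0 ?char_poly_monic.
have := max_poly_roots (rs := [seq c i | i <- iota 0 m]) pnz _ _.
rewrite size_map size_iota size_char_poly ltnS; apply; last first.
  by rewrite map_inj_uniq ?iota_uniq.
rewrite all_map; apply/allP => i; rewrite mem_iota => /andP[_ /eig[v vnz Mv]] /=.
suff : root (char_poly M^T) (c i).
  rewrite /char_poly -[\det (char_poly_mx M)]det_tr.
  by congr (root (\det _) _); apply/matrixP => k l; rewrite !mxE eq_sym.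
rewrite -eigenvalue_root_char; apply/eigenvalueP; exists v^T.
  by rewrite -trmx_mul Mv linearZ.
by rewrite -(trmx0 F) (inj_eq trmx_inj).
Qed.

Lemma natr_shift_inj (a : F) : injective (fun j => a - (2 * j)%:R).
Proof.
move=> i j /addrI/oppr_inj/(@mulrIn F 1 (oner_neq0 _))/eqP.
by rewrite eqn_pmul2l // => /eqP.
Qed.

(** Both f and e shift weights, so iterating either one on a weight vector
    produces vectors of pairwise distinct weights, and one of them is 0. *)
Lemma weight_string_eq0 V (c : nat -> F) (u : nat -> 'cV_(rdim V)) :
  injective c -> (forall j, V sl2_h *m u j = c j *: u j) -> exists j, u j == 0.
Proof.
move=> c_inj hu; case: (boolP [exists j : 'I_(rdim V).+1, u j == 0]).
  by case/existsP => j ?; exists j.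
rewrite negb_exists => /forallP nz.
suff : ((rdim V).+1 <= rdim V)%N by rewrite ltnn.
apply: (@eigenvalues_leq _ (V sl2_h) c) => // i im.
by exists (u i); first exact: (nz (Ordinal im)).
Qed.

(** If f^(m+1) v is the first zero of the string, then applying e to it gives
    (m+1)(a-m) f^m v = 0, hence a = m. *)
Lemma hwv_weight V a (v : 'cV_(rdim V)) : hwv a v -> v != 0 ->
  exists m : nat, [/\ a = m%:R, fpow m.+1 v = 0 &
                      forall j, (j <= m)%N -> fpow j v != 0].
Proof.
move=> hv vnz.
have /ex_minnP[[|m]] : exists j, fpow j v == 0.
- apply: weight_string_eq0 (natr_shift_inj (a := a)) _ => j.
  by apply: h_fpow; case: hv.
- by rewrite (negPf vnz).
move=> /eqP fm0 min_m.
have nz j : (j <= m)%N -> fpow j v != 0.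
  by move=> jm; apply/negP => /min_m; rewrite ltnNge jm.
exists m; split=> //; apply/eqP; rewrite -subr_eq0.
have := e_fpow m hv; rewrite fm0 mulmx0 => /esym/eqP.
by rewrite scaler_eq0 (negPf (nz _ _)) // orbF mulf_eq0 pnatr_eq0.
Qed.

(** Unlike hwv_weight, this also covers v = 0, which spares a case distinction
    when a morphism out of an irreducible is defined. *)
Lemma hwv_fpow0 V m (v : 'cV_(rdim V)) : hwv m%:R v -> fpow m.+1 v = 0.
Proof.
move=> hv; have [->|vnz] := eqVneq v 0.
  by elim: (m.+1) => [//|j IH]; rewrite fpowS IH mulmx0.
have [m' [/eqP]] := hwv_weight hv vnz.
by rewrite eqr_nat => /eqP ->.
Qed.

(** Apply e to an eigenvector of h as long as the result is nonzero. *)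
Lemma ex_hwv V : (0 < rdim V)%N ->
  exists a, exists2 v : 'cV_(rdim V), v != 0 & hwv a v.
Proof.
move=> V_gt0.
have /closed_rootP[a] : size (char_poly (V sl2_h)^T) != 1.
  by rewrite size_char_poly eqSS -lt0n.
rewrite -eigenvalue_root_char => /eigenvalueP[u hu unz].
have hv : V sl2_h *m u^T = a *: u^T.
  by apply: trmx_inj; rewrite trmx_mul trmxK hu linearZ /= trmxK.
have vnz : u^T != 0 by rewrite -(trmx0 F) (inj_eq trmx_inj).
have /ex_minnP[[|m]] : exists j, epow j u^T == 0.
- apply: (@weight_string_eq0 V (fun j => a + (2 * j)%:R)) => [i j|j].
    move=> /addrI/(@mulrIn F 1 (oner_neq0 _))/eqP.
    by rewrite eqn_pmul2l // => /eqP.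
  exact: h_epow.
- by rewrite (negPf vnz).
move=> /eqP em0 min_m; exists (a + (2 * m)%:R), (epow m u^T).
  by apply/negP => /min_m; rewrite ltnn.
by split; last exact: h_epow.
Qed.

Lemma invariant_gen V (U : {vspace 'cV[F]_(rdim V)}) :
  (forall v, v \in U -> V sl2_h *m v \in U) ->
  (forall v, v \in U -> V sl2_e *m v \in U) ->
  (forall v, v \in U -> V sl2_f *m v \in U) -> Defs.invariant U.
Proof.
move=> Uh Ue Uf x v Uv; rewrite [x]sl2_decomp !linearD !linearZ /= !mulmxDl.
by rewrite -!scalemxAl !memvD // memvZ ?Uh ?Ue ?Uf.
Qed.

Definition fstring V (v : 'cV_(rdim V)) m := [seq fpow j v | j <- iota 0 m].

Lemma free_fstring V m n (v : 'cV_(rdim V)) :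
  (m <= n)%N -> free (fstring v n) -> free (fstring v m).
Proof.
by move=> /subnKC <-; rewrite /fstring iotaD map_cat; apply: catl_free.
Qed.

Lemma fstring_invariant V m (v : 'cV_(rdim V)) : hwv m%:R v ->
  Defs.invariant <<fstring v m.+1>>%VS.
Proof.
move=> hv.
have mem j : (j < m.+1)%N -> fpow j v \in <<fstring v m.+1>>%VS.
  by move=> jm; apply/memv_span/(map_f (fun j => fpow j v)); rewrite mem_iota.
have stable x : (forall j, (j < m.+1)%N -> V x *m fpow j v \in <<fstring v m.+1>>%VS) ->
    forall w, w \in <<fstring v m.+1>>%VS -> V x *m w \in <<fstring v m.+1>>%VS.
  move=> st w /(memv_img (linfun (mulmx (V x)))); rewrite lfunE /= limg_span.
  apply: subvP; apply/span_subvP => _ /mapP[_ /mapP[j jm ->] ->].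
  by rewrite lfunE /= st //; move: jm; rewrite mem_iota.
apply: invariant_gen; apply: stable => j jm.
- by rewrite (h_fpow _ (proj2 hv)) memvZ ?mem.
- case: j jm => [|j] jm; first by rewrite [fpow 0 v]/= (proj1 hv) mem0v.
  by rewrite (e_fpow _ hv) memvZ ?mem // ltnW.
- rewrite -fpowS; have [jm'|] := ltnP j m; first exact: mem.
  move=> mj; have -> : j = m by lia.
  by rewrite hwv_fpow0 ?mem0v.
Qed.

Lemma dim_cV n : \dim {:'cV[F]_n} = n.
Proof. by rewrite dimvf; apply: muln1. Qed.

(** The string of a highest weight vector spans an invariant subspace, hence
    everything.  It has m+1 members where m is the weight, and dim V >= m+1 since
    h has the m+1 eigenvalues m, m-2, ..., -m; so m+1 = dim V and the string is a
    basis. *)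
Lemma irreducible_fbasis V : irreducible V ->
  exists2 v : 'cV_(rdim V), hwv (rdim V).-1%:R v &
    basis_of fullv (fstring v (rdim V)).
Proof.
case=> V_gt0 irrV; have [a [v vnz hv]] := ex_hwv V_gt0.
have [m [am _ nz]] := hwv_weight hv vnz; rewrite {a}am in hv.
have m_lt : (m.+1 <= rdim V)%N.
  apply: (@eigenvalues_leq _ (V sl2_h) (fun j => m%:R - (2 * j)%:R)).
    exact: natr_shift_inj.
  by move=> i /nz im; exists (fpow i v) => //; apply: h_fpow; case: hv.
have full : <<fstring v m.+1>>%VS = fullv.
  case: (irrV _ (fstring_invariant hv)) => // U0.
  have : v \in <<fstring v m.+1>>%VS by rewrite memv_span ?mem_head.
  by rewrite U0 memv0 (negPf vnz).
have sz : size (fstring v m.+1) = m.+1 by rewrite size_map size_iota.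
have dimV : rdim V = m.+1.
  by apply/eqP; rewrite eqn_leq m_lt -[X in (X <= _)%N]dim_cV -full -{2}sz dim_span.
exists v; first by rewrite dimV.
have -> : fstring v (rdim V) = fstring v m.+1 by congr (fstring v _).
by rewrite basisEdim dim_cV full subvv sz.
Qed.

Lemma epow_mx V r : exists M, forall x : 'cV_(rdim V), epow r x = M *m x.
Proof.
elim: r => [|r [M eM]]; first by exists 1%:M => x; rewrite mul1mx.
by exists (V sl2_e *m M) => x; rewrite epowS eM mulmxA.
Qed.

Definition intertwining V W (Phi : 'Hom('cV[F]_(rdim V), 'cV[F]_(rdim W))) :=
  forall x v, Phi (V x *m v) = W x *m Phi v.

Lemma intertwining_gen V W (Phi : 'Hom('cV[F]_(rdim V), 'cV[F]_(rdim W))) :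
  (forall v, Phi (V sl2_h *m v) = W sl2_h *m Phi v) ->
  (forall v, Phi (V sl2_e *m v) = W sl2_e *m Phi v) ->
  (forall v, Phi (V sl2_f *m v) = W sl2_f *m Phi v) -> intertwining Phi.
Proof.
move=> Ph Pe Pf x v; rewrite [x]sl2_decomp !linearD !linearZ /= !mulmxDl.
by rewrite -!scalemxAl !linearD !linearZ /= Ph Pe Pf.
Qed.

(** * Representations with a string basis *)
Section StringBasis.
Variables (V : rep F) (v : 'cV[F]_(rdim V)).
Hypotheses (V_gt0 : (0 < rdim V)%N) (hv : hwv (rdim V).-1%:R v)
           (bv : basis_of fullv (fstring v (rdim V))).

Lemma fbasis_ind (U : {vspace 'cV[F]_(rdim V)}) :
  (forall j, (j < rdim V)%N -> fpow j v \in U) -> forall x, x \in U.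
Proof.
move=> Uv x; have /subvP : (<<fstring v (rdim V)>> <= U)%VS.
  by apply/span_subvP => _ /mapP[j jm ->]; apply: Uv; move: jm; rewrite mem_iota.
by apply; rewrite (span_basis bv) memvf.
Qed.

Lemma epow_eq0 r (x : 'cV[F]_(rdim V)) : (rdim V <= r)%N -> epow r x = 0.
Proof.
move=> rV; have [M eM] := epow_mx V r.
suff : x \in lker (linfun (mulmx M)) by rewrite memv_ker lfunE /= eM => /eqP.
apply: fbasis_ind => j /leq_trans/(_ rV); rewrite memv_ker lfunE /= -eM => {M eM rV}.
elim: r j => [//|r IH] [|j] jr; rewrite /epow iterSr -/(epow _ _).
  rewrite [fpow 0 v]/= (proj1 hv); have [M ->] := epow_mx V r.
  by rewrite mulmx0.
rewrite (e_fpow _ hv); have [M eM] := epow_mx V r.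
by rewrite eM -scalemxAr -eM (eqP (IH _ _)) ?scaler0.
Qed.

(** The image of e contains f^j v for j < dim V - 1 by e_fpow, so e has rank at
    least dim V - 1, and its kernel is a line, that of v. *)
Lemma fbasis_ker (x : 'cV[F]_(rdim V)) : V sl2_e *m x = 0 -> x \in <[v]>%VS.
Proof.
move=> ex; pose E : 'End('cV[F]_(rdim V)) := linfun (mulmx (V sl2_e)).
have vK : v \in lker E by rewrite memv_ker lfunE /= (proj1 hv).
have vnz : v != 0.
  apply: (free_not0 (basis_free bv)).
  by apply/mapP; exists 0%N; rewrite ?mem_iota.
suff lekk : (\dim (lker E) <= 1)%N.
  suff -> : <[v]>%VS = lker E by rewrite memv_ker lfunE /= ex.
  by apply/eqP; rewrite eqEdim -memvE vK dim_vline vnz.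
have sub : (<<fstring v (rdim V).-1>> <= E @: fullv)%VS.
  apply/span_subvP => y /mapP[j]; rewrite mem_iota add0n => /andP[_ jV] -> {y}.
  have nz : j.+1%:R * ((rdim V).-1%:R - j%:R) != 0 :> F.
    by rewrite mulf_neq0 ?pnatr_eq0 // subr_eq0 eqr_nat neq_ltn jV orbT.
  apply/memv_imgP; exists ((j.+1%:R * ((rdim V).-1%:R - j%:R))^-1 *: fpow j.+1 v).
    exact: memvf.
  by rewrite lfunE /= -scalemxAr (e_fpow _ hv) scalerA mulVf ?scale1r.
have fr : free (fstring v (rdim V).-1).
  exact: free_fstring (leq_pred _) (basis_free bv).
have := limg_ker_dim E fullv; rewrite capfv dim_cV.
have := dimvS sub; rewrite (eqnP fr) size_map size_iota; lia.
Qed.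

(** The action of e, f and h on a string depends only on the weight of its first
    vector, so mapping f^j v to f^j u is a morphism, even if the string of u is
    not free. *)
Lemma fbasis_hom W (u : 'cV[F]_(rdim W)) : hwv (rdim V).-1%:R u ->
  exists2 Phi : 'Hom('cV[F]_(rdim V), 'cV[F]_(rdim W)),
    intertwining Phi & Phi v = u.
Proof.
move=> hu; have [g] := linear_of_free (fstring v (rdim V)) (fstring u (rdim V)).
move=> /(_ (basis_free bv)); rewrite !size_map => /(_ (erefl _)) gvu.
pose f : 'Hom('cV[F]_(rdim V), 'cV[F]_(rdim W)) := linfun g.
have fE j : (j < rdim V)%N -> f (fpow j v) = fpow j u.
  move=> jV; have /(congr1 (nth 0 ^~ j)) := gvu.
  by rewrite -map_comp !(nth_map 0%N) ?size_iota ?nth_iota //= lfunE.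
exists f; last exact: (fE 0%N).
have step x : (forall j, (j < rdim V)%N -> f (V x *m fpow j v) = W x *m f (fpow j v)) ->
    forall y, f (V x *m y) = W x *m f y.
  move=> fx y; pose L := (f \o linfun (mulmx (V x)))%VF.
  pose R := (linfun (mulmx (W x)) \o f)%VF.
  suff /eqlfunP : y \in lker (L - R) by rewrite !comp_lfunE !lfunE.
  apply: fbasis_ind => j jV; apply/eqlfunP; move: (fx j jV).
  by rewrite !comp_lfunE !lfunE.
apply: intertwining_gen; apply: step => j jV; rewrite (fE j) //.
- by rewrite (h_fpow _ (proj2 hv)) (h_fpow _ (proj2 hu)) linearZ /= fE.
- case: j jV => [|j] jV.
    by rewrite [fpow 0 v]/= [fpow 0 u]/= (proj1 hv) (proj1 hu) linear0.
  by rewrite (e_fpow _ hv) (e_fpow _ hu) linearZ /= fE // ltnW.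
- rewrite -!fpowS; have [jm'|Vj] := ltnP j (rdim V).-1.
    by rewrite fE // -ltn_predRL.
  (* The last step of the string: f kills both ends. *)
  have -> : j = (rdim V).-1 by lia.
  by rewrite (hwv_fpow0 hv) (hwv_fpow0 hu) linear0.
Qed.
End StringBasis.

(** * Embedding a direct sum of irreducibles from its highest weight vectors *)

(** The hypothesis carried along an iterated direct sum A.  Besides a morphism
    A -> V, it records the two facts that make this morphism injective (e is
    nilpotent on A, and no nonzero vector killed by e is sent to 0), and a
    subspace U that contains the images of the vectors killed by e, so that two
    such morphisms can be added when their subspaces U are independent. *)
Definition embeds V A (U : {vspace 'cV[F]_(rdim V)}) :=
  (exists r, forall x : 'cV_(rdim A), epow r x = 0) /\
  exists2 Phi : 'Hom('cV[F]_(rdim A), 'cV[F]_(rdim V)), intertwining Phi &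
    forall x, A sl2_e *m x = 0 -> Phi x \in U /\ (Phi x = 0 -> x = 0).

Lemma embeds_zero V : embeds (rep_zero F) (0 : {vspace 'cV[F]_(rdim V)}).
Proof.
have z (x : 'cV[F]_(rdim (rep_zero F))) : x = 0 by apply/matrixP => -[].
split; first by exists 0%N => x; rewrite [x]z.
exists 0 => [x v|x _]; first by rewrite !lfunE /= mulmx0.
by rewrite [x]z linear0 mem0v.
Qed.

(** By fbasis_ker the only vectors of A killed by e are the multiples of its
    highest weight vector, which goes to u. *)
Lemma embeds_irr V A (u : 'cV_(rdim V)) :
  irreducible A -> u != 0 -> hwv (rdim A).-1%:R u -> embeds A <[u]>%VS.
Proof.
move=> irrA unz hu; have [v hv bv] := irreducible_fbasis irrA.
have A_gt0 := proj1 irrA.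
split; first by exists (rdim A) => x; apply: (epow_eq0 hv bv).
have [Phi Phi_int Phiv] := fbasis_hom A_gt0 hv bv hu; exists Phi => // x ex.
have /vlineP[c ->] := fbasis_ker A_gt0 hv bv ex.
rewrite linearZ /= Phiv; split; first by rewrite memvZ ?memv_line.
by move/eqP; rewrite scaler_eq0 (negPf unz) orbF => /eqP ->; rewrite scale0r.
Qed.

Lemma act_dsum A B x (v : 'cV_(rdim (dsum A B))) :
  dsum A B x *m v =
    col_mx (A x *m usubmx (v : 'cV_(rdim A + rdim B)))
           (B x *m dsubmx (v : 'cV_(rdim A + rdim B))).
Proof.
rewrite -{1}[v]vsubmxK [LHS]mul_block_col.
by rewrite !mul0mx addr0 add0r.
Qed.

Lemma epow_dsum A B r (v : 'cV_(rdim (dsum A B))) :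
  epow r v = col_mx (epow r (usubmx (v : 'cV_(rdim A + rdim B))))
                    (epow r (dsubmx (v : 'cV_(rdim A + rdim B)))).
Proof.
elim: r => [|r IH]; first by rewrite [RHS]vsubmxK.
by rewrite !epowS IH act_dsum col_mxKu col_mxKd.
Qed.

Lemma epow_eq0_leq V r r' (x : 'cV_(rdim V)) :
  (r <= r')%N -> epow r x = 0 -> epow r' x = 0.
Proof.
move=> /subnK <- er; rewrite /epow iterD -!/(epow _ _) er.
by have [M ->] := epow_mx V (r' - r); rewrite mulmx0.
Qed.

Lemma embeds_dsum V A B (U W : {vspace 'cV[F]_(rdim V)}) :
  (U :&: W = 0)%VS -> embeds A U -> embeds B W -> embeds (dsum A B) (U + W)%VS.
Proof.
move=> UW0 [[r eA] [f f_int fU]] [[r' eB] [g g_int gW]]; split.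
  exists (maxn r r') => x; rewrite epow_dsum.
  rewrite (epow_eq0_leq _ (eA _)) ?leq_maxl //.
  by rewrite (epow_eq0_leq _ (eB _)) ?leq_maxr ?col_mx0.
pose up : 'Hom('cV[F]_(rdim A + rdim B), 'cV[F]_(rdim A)) := linfun usubmx.
pose dn : 'Hom('cV[F]_(rdim A + rdim B), 'cV[F]_(rdim B)) := linfun dsubmx.
pose Phi : 'Hom('cV[F]_(rdim (dsum A B)), 'cV[F]_(rdim V)) :=
  ((f \o up) + (g \o dn))%VF.
have PhiE v : Phi v = f (usubmx (v : 'cV_(rdim A + rdim B))) +
                      g (dsubmx (v : 'cV_(rdim A + rdim B))).
  by rewrite add_lfunE !comp_lfunE !lfunE.
exists Phi => [x v|x].
  by rewrite !PhiE act_dsum col_mxKu col_mxKd f_int g_int mulmxDr.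
rewrite act_dsum -[X in _ = X]col_mx0 => /eq_col_mx[ex1 ex2]; rewrite PhiE.
have [fx f0] := fU _ ex1; have [gx g0] := gW _ ex2.
split=> [|/eqP]; first exact: memv_add.
rewrite addr_eq0 => /eqP fg.
have fx0 : f (usubmx (x : 'cV_(rdim A + rdim B))) = 0.
  by apply/eqP; rewrite -memv0 -UW0 memv_cap fx fg memvN gx.
have gx0 : g (dsubmx (x : 'cV_(rdim A + rdim B))) = 0.
  by apply/eqP; rewrite -oppr_eq0 -fg fx0.
by rewrite -[x](@vsubmxK _ (rdim A) (rdim B)) (f0 fx0) (g0 gx0) col_mx0.
Qed.

Lemma embeds_copies V A (us : seq 'cV_(rdim V)) :
  irreducible A -> free us -> (forall u, u \in us -> hwv (rdim A).-1%:R u) ->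
  embeds (copies (size us) A) <<us>>%VS.
Proof.
move=> irrA; elim: us => [|u us IH] free_us hus.
  by rewrite span_nil; apply: embeds_zero.
have u_nz := free_not0 free_us (mem_head _ _).
move: free_us; rewrite free_cons => /andP[u_us free_us].
rewrite span_cons /=; apply: embeds_dsum.
- apply/eqP; rewrite -subv0; apply/subvP => x; rewrite memv_cap.
  case/andP=> /vlineP[c ->]; have [->|cnz] := eqVneq c 0.
    by rewrite scale0r !mem0v.
  by rewrite rpredZeq (negPf cnz) (negPf u_us).
- by apply: embeds_irr => //; apply: hus; rewrite mem_head.
- by apply: IH => // w wus; apply: hus; rewrite inE wus orbT.
Qed.

(** If x is nonzero in the kernel, then so is the last nonzero e^i x, which is
    killed by e. *)
Lemma embeds_inj V A (U : {vspace 'cV[F]_(rdim V)}) : embeds A U ->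
  exists2 Phi : 'Hom('cV[F]_(rdim A), 'cV[F]_(rdim V)),
    intertwining Phi & lker Phi == 0%VS.
Proof.
case=> [[r er] [Phi Phi_int PhiU]]; exists Phi => //.
rewrite -subv0; apply/subvP => x; rewrite memv_ker memv0.
suff : forall r (x : 'cV_(rdim A)), epow r x = 0 -> Phi x = 0 -> x = 0.
  by move=> + /eqP Phix => /(_ r x (er x) Phix) ->.
elim=> {r er x} [//|r IH] x; rewrite /epow iterSr -/(epow _ _) => er Phix.
have [] := PhiU x; first by apply: IH => //; rewrite Phi_int Phix mulmx0.
by move=> _; apply.
Qed.

Lemma rep_iso_of_inj V A (Phi : 'Hom('cV[F]_(rdim A), 'cV[F]_(rdim V))) :
  intertwining Phi -> lker Phi == 0%VS -> rdim A = rdim V -> rep_iso V A.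
Proof.
move=> Phi_int Phi0 dimAV.
have full : limg Phi = fullv.
  have dimPhi := @limg_dim_eq _ _ _ Phi fullv.
  apply/eqP; rewrite eqEdim subvf dim_cV dimPhi ?dim_cV ?dimAV //=.
  by rewrite capfv; apply/eqP.
have K1 := lker0_lfunK Phi0.
have K2 : cancel (Phi^-1)%VF Phi by move=> u; rewrite limg_lfunVK // full memvf.
exists (Phi^-1)%VF; split; first by exists Phi.
by move=> x v; apply: (can_inj K1); rewrite K2 Phi_int K2.
Qed.

End Sl2Theory.
Arguments sl2_e {F}.
Arguments sl2_f {F}.
Arguments sl2_h {F}.

(** * Decomposition from weight multiplicities *)
Section Weights.
Variable F : numClosedFieldType.
Implicit Types (V W A B : rep F).

(** The columns of P are eigenvectors of h; giving an inverse of P instead of its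
    invertibility is what direct sums and tensor products of matrices preserve
    by computation, in every dimension. *)
Definition weighted V (wt : 'I_(rdim V) -> int) :=
  exists P Q : 'M[F]_(rdim V),
    P *m Q = 1%:M /\ V sl2_h *m P = P *m diag_mx (\row_i (wt i)%:~R).

Definition wt_mult n (wt : 'I_n -> int) (mu : int) : nat := #|[pred i | wt i == mu]|.

Definition wspace V (mu : int) : {vspace 'cV[F]_(rdim V)} :=
  lker (linfun (mulmx (V sl2_h - mu%:~R%:M))).

Lemma wspaceP V mu (x : 'cV_(rdim V)) :
  reflect (V sl2_h *m x = mu%:~R *: x) (x \in wspace V mu).
Proof.
rewrite memv_ker lfunE /= mulmxBl mul_scalar_mx subr_eq0; exact: eqP.
Qed.

Lemma mulmx_sum_col m n (M : 'M[F]_(m, n)) (c : 'cV_n) :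
  M *m c = \sum_i c i 0 *: col i M.
Proof.
apply/matrixP => i j; rewrite ord1 summxE mxE.
by apply: eq_bigr => k _; rewrite !mxE mulrC.
Qed.

Section Basis.
Variables (V : rep F) (wt : 'I_(rdim V) -> int) (P Q : 'M[F]_(rdim V)).
Hypotheses (PQ : P *m Q = 1%:M)
           (hP : V sl2_h *m P = P *m diag_mx (\row_i (wt i)%:~R)).

Lemma wspace_coord mu (x : 'cV_(rdim V)) i :
  x \in wspace V mu -> (Q *m x) i 0 != 0 -> wt i = mu.
Proof.
have hQ : Q *m V sl2_h = diag_mx (\row_i (wt i)%:~R) *m Q.
  by rewrite -[LHS]mulmx1 -PQ mulmxA -(mulmxA Q) hP !mulmxA (mulmx1C PQ) mul1mx.
move=> /wspaceP hx nz; apply: (@mulrIz F 1); first exact: oner_neq0.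
apply: (mulIf nz).
have /matrixP/(_ i 0) : Q *m (V sl2_h *m x) = Q *m (mu%:~R *: x) by rewrite hx.
by rewrite mulmxA hQ -mulmxA mul_diag_mx -scalemxAr !mxE.
Qed.

(** The weight space has for basis the columns of P of that weight. *)
Lemma dim_wspace mu : \dim (wspace V mu) = wt_mult wt mu.
Proof.
pose X s := [seq col i P | i <- s].
have xE x : x = \sum_i (Q *m x) i 0 *: col i P.
  by rewrite -mulmx_sum_col mulmxA PQ mul1mx.
have free_all : free (X (enum 'I_(rdim V))).
  apply: (@basis_free _ _ fullv).
  rewrite basisEdim size_map size_enum_ord dim_cV leqnn andbT.
  apply/subvP => x _; rewrite [x]xE; apply: memv_suml => i _.
  by apply/memvZ/memv_span/map_f; rewrite mem_enum.
have free_mu : free (X (enum [pred i | wt i == mu])).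
  have -> : enum [pred i | wt i == mu] = [seq i <- enum 'I_(rdim V) | wt i == mu].
    by rewrite enumT; apply: eq_filter.
  have := perm_map (fun i => col i P)
    (permEl (perm_filterC (fun i => wt i == mu) (enum 'I_(rdim V)))).
  by move/perm_free; rewrite free_all map_cat => /catl_free.
rewrite /wt_mult cardE -(size_map (fun i => col i P)) -(eqnP free_mu); congr (\dim _).
apply/vspaceP => x; apply/idP/idP => [xmu | ].
  rewrite [x]xE; apply: memv_suml => i _.
  have [->|nz] := eqVneq ((Q *m x) i 0) 0; first by rewrite scale0r mem0v.
  apply/memvZ/memv_span/(map_f (fun i => col i P)).
  by rewrite mem_enum inE (wspace_coord xmu nz).
move: x; apply/subvP; apply/span_subvP/allP; rewrite all_map; apply/allP => i.
rewrite mem_enum inE => /eqP wti /=.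
apply/wspaceP.
have -> : V sl2_h *m col i P = col i (V sl2_h *m P) by rewrite !colE mulmxA.
rewrite hP mul_mx_diag; apply/matrixP => k l.
by rewrite !mxE wti mulrC.
Qed.

Lemma e_wspace mu (x : 'cV_(rdim V)) :
  x \in wspace V mu -> V sl2_e *m x \in wspace V (mu + 2).
Proof.
move=> /wspaceP hx; apply/wspaceP.
by rewrite act_he hx -scalemxAr -scalerDl intrD.
Qed.

(** Since e maps the weight space mu to the weight space mu + 2, its kernel on
    the former has at least the difference of the two dimensions. *)
Lemma ex_free_hwv mu : exists us : seq 'cV[F]_(rdim V),
  [/\ size us = (wt_mult wt mu - wt_mult wt (mu + 2))%N, free us &
      forall u, u \in us -> hwv mu%:~R u].
Proof.
pose E : 'End('cV[F]_(rdim V)) := linfun (mulmx (V sl2_e)).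
pose K := (wspace V mu :&: lker E)%VS.
have leK : (wt_mult wt mu - wt_mult wt (mu + 2) <= \dim K)%N.
  have := limg_ker_dim E (wspace V mu); rewrite -/K dim_wspace => <-.
  rewrite leq_subLR addnC leq_add2r -dim_wspace; apply: dimvS.
  by apply/subvP => _ /memv_imgP[x xmu ->]; rewrite lfunE /= e_wspace.
exists (take (wt_mult wt mu - wt_mult wt (mu + 2)) (vbasis K)); split.
- by rewrite size_takel // size_tuple.
- have := basis_free (vbasisP K).
  set m := (_ - _)%N.
  by rewrite -{1}[X in free X](cat_take_drop m) => /catl_free.
- move=> u /mem_take/vbasis_mem; rewrite memv_cap memv_ker lfunE /=.
  by case/andP => /wspaceP hu /eqP eu.
Qed.

Variable irr : nat -> rep F.
Hypothesis irrP :
  forall k : nat, (0 < k)%N -> rdim (irr k) = k /\ irreducible (irr k).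

Lemma embeds_copies_irr k : (0 < k)%N ->
  exists2 U : {vspace 'cV[F]_(rdim V)}, (U <= wspace V k.-1)%VS &
    embeds (copies (wt_mult wt k.-1 - wt_mult wt k.+1) (irr k)) U.
Proof.
move=> k_gt0; have [dimk irrk] := irrP k_gt0.
have [us [sz free_us hus]] := ex_free_hwv k.-1.
have -> : k.+1 = k.-1%:Z + 2 :> int by lia.
exists <<us>>%VS.
  by apply/span_subvP => u /hus[_ hu]; apply/wspaceP.
rewrite -sz; apply: embeds_copies => // u /hus; rewrite dimk.
by rewrite pmulrn.
Qed.

(** Highest weight vectors for distinct k lie in distinct weight spaces, which
    are independent: this is tracked on coordinates in the eigenbasis P.  The
    list s is arbitrary so that the induction may follow the iterated sum. *)
Lemma embeds_sum (s : seq nat) : uniq s -> all (leq 1) s ->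
  exists2 U : {vspace 'cV[F]_(rdim V)},
    (forall x, x \in U -> forall i, (Q *m x) i 0 != 0 ->
       exists2 k : nat, k \in s & wt i = k.-1) &
    embeds (\big[@dsum F / rep_zero F]_(k <- s)
              copies (wt_mult wt k.-1 - wt_mult wt k.+1) (irr k)) U.
Proof.
elim: s => [|k s IH] /=.
  exists 0%VS; last by rewrite big_nil; apply: embeds_zero.
  by move=> x; rewrite memv0 => /eqP -> i; rewrite mulmx0 mxE eqxx.
case/andP=> ks us /andP[k_gt0 s_gt0].
have [W hW eW] := IH us s_gt0; have [U hU eU] := embeds_copies_irr k_gt0.
have wtU x i : x \in U -> (Q *m x) i 0 != 0 -> wt i = k.-1.
  by move=> /(subvP hU); apply: wspace_coord.
exists (U + W)%VS.
  move=> _ /memv_addP[x xU [y yW ->]] i; rewrite mulmxDr mxE => nz.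
  have [x0|xnz] := eqVneq ((Q *m x) i 0) 0.
    move: nz; rewrite x0 add0r => /(hW _ yW)[l ls wtl].
    by exists l; rewrite // inE ls orbT.
  by exists k; rewrite ?mem_head // (wtU _ _ xU xnz).
rewrite big_cons; apply: embeds_dsum => //.
apply/eqP; rewrite -subv0; apply/subvP => x; rewrite memv_cap => /andP[xU xW].
have Qx0 : Q *m x = 0.
  apply/matrixP => i j; rewrite ord1 [RHS]mxE; apply/eqP/negPn/negP => nz.
  have [l ls] := hW _ xW _ nz; rewrite (wtU _ _ xU nz) => kl.
  have l_gt0 := allP s_gt0 _ ls.
  by move/negP: ks; apply; have -> : k = l by lia.
by rewrite memv0 -[x]mul1mx -PQ -mulmxA Qx0 mulmx0.
Qed.

End Basis.

Lemma rdim_copies m V : rdim (copies m V) = (m * rdim V)%N.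
Proof. by elim: m => //= m ->; rewrite mulSn. Qed.

Lemma rdim_bigdsum (s : seq nat) (A : nat -> rep F) :
  rdim (\big[@dsum F / rep_zero F]_(k <- s) A k) = (\sum_(k <- s) rdim (A k))%N.
Proof. by elim: s => [|k s IH]; rewrite ?big_nil // !big_cons /= IH. Qed.

(** Abel summation; the two boundary terms vanish once N exceeds all weights. *)
Lemma sum_differences (w : nat -> nat) N :
  (forall k, (w k.+2 <= w k)%N) ->
  (\sum_(1 <= k < N.+1) (w k.-1 - w k.+1) * k + N.+1 * w N + N * w N.+1)%N =
  (w 0 + 2 * \sum_(1 <= k < N.+1) w k)%N.
Proof.
move=> w_dec; elim: N => [|N IH]; first by rewrite !big_geq //; lia.
rewrite !(big_nat_recr N.+1) //=; have := w_dec N; nia.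
Qed.

(** Sort the indices by absolute value of the weight; by symmetry, each nonzero
    value is taken by k and by -k equally often. *)
Lemma card_wt_mult n (wt : 'I_n -> int) N :
  (forall mu, wt_mult wt (- mu) = wt_mult wt mu) ->
  (forall i, (`|wt i| < N.+1)%N) ->
  n = (wt_mult wt 0 + 2 * \sum_(1 <= k < N.+1) wt_mult wt k)%N.
Proof.
move=> sym bnd; rewrite -[LHS]card_ord -sum1_card.
have one i : 1%N = (\sum_(0 <= k < N.+1) (`|wt i|%N == k :> nat))%N.
  rewrite big_mkord (bigD1 (Ordinal (bnd i))) //= eqxx big1 // => j.
  by rewrite -val_eqE /= eq_sym => /negPf ->.
rewrite (eq_bigr _ (fun i _ => one i)).
rewrite exchange_big big_ltn //=; congr (_ + _)%N.
  rewrite /wt_mult -sum1_card big_mkcond [RHS]big_mkcond /=; apply: eq_bigr => i _.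
  by rewrite inE absz_eq0; case: (wt i == 0).
rewrite big_distrr; apply: eq_big_nat => k /andP[k_gt0 _] /=.
rewrite mul2n -addnn -{2}sym /wt_mult -!sum1_card [X in (X + _)%N]big_mkcond.
rewrite [X in (_ + X)%N]big_mkcond -big_split /=; apply: eq_bigr => i _.
rewrite !inE; do 3 case: eqP; lia.
Qed.

(** The symmetry of the weights makes the dimension of the direct sum, which
    embeds in V, equal to that of V.  The monotonicity ensures that the truncated
    differences are the true ones. *)
Theorem weighted_decomp V (wt : 'I_(rdim V) -> int) (irr : nat -> rep F) :
  (forall k : nat, (0 < k)%N -> rdim (irr k) = k /\ irreducible (irr k)) ->
  weighted wt ->
  (forall mu, wt_mult wt (- mu) = wt_mult wt mu) ->
  (forall k : nat, (wt_mult wt k.+2 <= wt_mult wt k)%N) ->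
  exists N : nat, (forall k : nat, (N <= k)%N -> wt_mult wt k = 0%N) /\
    rep_iso V (\big[@dsum F / rep_zero F]_(1 <= k < N.+1)
                 copies (wt_mult wt k.-1 - wt_mult wt k.+1) (irr k)).
Proof.
move=> irrP [P [Q [PQ hP]]] sym dec.
(* One more than the largest weight, so that N itself is not a weight. *)
pose N := (\max_i `|wt i|%N).+1; exists N.
have bnd i : (`|wt i| < N)%N by rewrite ltnS (@leq_bigmax _ (fun i => `|wt i|%N)).
have mult0 k : (N <= k)%N -> wt_mult wt k = 0%N.
  move=> Nk; apply: eq_card0 => i; rewrite inE; apply/negP => /eqP wti.
  by have := bnd i; rewrite wti; lia.
split=> //; have [] := @embeds_sum V wt P Q PQ hP irr irrP (index_iota 1 N.+1).
- exact: iota_uniq.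
- by apply/allP => k; rewrite mem_index_iota => /andP[].
move=> U _ /embeds_inj[Phi Phi_int Phi0]; apply: rep_iso_of_inj Phi_int Phi0 _.
rewrite rdim_bigdsum; apply/esym/(etrans (card_wt_mult sym (fun i => ltnW (bnd i)))).
rewrite -(sum_differences N dec) !mult0 // !muln0 !addn0.
apply: eq_big_nat => k /andP[k_gt0 _].
by rewrite rdim_copies (proj1 (irrP _ k_gt0)).
Qed.
End Weights.

(** * Weights of irreducibles, direct sums and tensor products *)
Section WeightConstructions.
Variable F : numClosedFieldType.
Implicit Types (V W A B : rep F).

Definition dsum_wt m n (u : 'I_m -> int) (w : 'I_n -> int) (i : 'I_(m + n)) :=
  match split i with inl j => u j | inr k => w k end.

Definition tens_wt m n (u : 'I_m -> int) (w : 'I_n -> int) (i : 'I_(m * n)) :=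
  u (mxtens_unindex i).1 + w (mxtens_unindex i).2.

Lemma weighted_triv : weighted (V := rep_triv F) (fun=> 0).
Proof.
exists 1%:M, 1%:M; split; first by rewrite mulmx1.
rewrite mulmx1 mul1mx; apply/matrixP => i j; rewrite !mxE.
by rewrite mulr0z mul0rn.
Qed.

Lemma weighted_dsum V W u w : weighted u -> weighted w ->
  weighted (V := dsum V W) (dsum_wt u w).
Proof.
case=> [P [Q [PQ hP]]] [P' [Q' [PQ' hP']]].
exists (block_mx P 0 0 P'), (block_mx Q 0 0 Q'); split.
  by rewrite mulmx_block !mul0mx !mulmx0 !addr0 add0r PQ PQ' -scalar_mx_block.
have -> : \row_i (dsum_wt u w i)%:~R =
    row_mx (\row_i (u i)%:~R) (\row_i (w i)%:~R) :> 'rV[F]_(rdim V + rdim W).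
  apply/rowP => i; rewrite !mxE /dsum_wt.
  by case: (split i) => j; rewrite mxE.
rewrite /= /dsum_act diag_mx_row !mulmx_block !mul0mx !mulmx0 !addr0 !add0r.
by rewrite hP hP'.
Qed.

Lemma tens1mx1 m n : (1%:M : 'M[F]_m) *t (1%:M : 'M[F]_n) = 1%:M.
Proof.
apply/matrixP => i j; case: (mxtens_indexP i) => i1 i2.
case: (mxtens_indexP j) => j1 j2; rewrite tensmxE !mxE -natrM mulnb.
by rewrite (can_eq (@mxtens_indexK _ _)).
Qed.

Lemma weighted_tens V W u w : weighted u -> weighted w ->
  weighted (V := tens V W) (tens_wt u w).
Proof.
case=> [P [Q [PQ hP]]] [P' [Q' [PQ' hP']]].
exists (P *t P'), (Q *t Q'); split.
  by rewrite tensmx_mul PQ PQ' tens1mx1.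
rewrite /= /tens_act mulmxDl !tensmx_mul !mul1mx hP hP' !mul_mx_diag.
apply/matrixP => i j; case: (mxtens_indexP i) => i1 i2.
case: (mxtens_indexP j) => j1 j2; rewrite [LHS]mxE !tensmxE !mxE /tens_wt.
by rewrite !mxtens_indexK /= rmorphD /=; ring.
Qed.

(** The weight of f^i v in the irreducible of dimension n. *)
Definition irr_wt (n i : nat) : int := n.-1%:Z - (2 * i)%:Z.

Lemma weighted_irr V : irreducible V ->
  weighted (fun i : 'I_(rdim V) => irr_wt (rdim V) i).
Proof.
move=> irrV; have [v hv bv] := irreducible_fbasis irrV.
pose P : 'M[F]_(rdim V) := \matrix_(i, j) (fpow j v) i 0.
have colP j : col j P = fpow j v.
  by apply/matrixP => i k; rewrite !mxE ord1.
have surj x : exists c : 'cV_(rdim V), P *m c = x.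
  pose L : 'End('cV[F]_(rdim V)) := linfun (mulmx P).
  have /memv_imgP[c _ ->] : x \in limg L; last by exists c; rewrite lfunE.
  apply: (fbasis_ind bv) => j jV; apply/memv_imgP.
  exists (delta_mx (Ordinal jV) 0); first exact: memvf.
  by rewrite lfunE /= -colE colP.
have [c Pc] := fin_all_exists (fun j : 'I_(rdim V) => surj (delta_mx j 0)).
exists P, (\matrix_(i, j) c j i 0); split.
  apply/matrixP => i j; have /matrixP/(_ i 0) := Pc j.
  rewrite !mxE andbT => <-; apply: eq_bigr => k _; by rewrite !mxE.
have colH j : V sl2_h *m col j P = (irr_wt (rdim V) j)%:~R *: col j P.
  by rewrite colP (h_fpow _ (proj2 hv)) /irr_wt rmorphB.
apply/matrixP => i j; have /matrixP/(_ i 0) := colH j.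
rewrite colE mulmxA -!colE mul_mx_diag !mxE mulrC => <-.
by apply: eq_bigr.
Qed.

Lemma sum_dsum_wt m n (u : 'I_m -> int) (w : 'I_n -> int) (g : int -> nat) :
  (\sum_i g (dsum_wt u w i) = \sum_i g (u i) + \sum_i g (w i))%N.
Proof.
rewrite big_split_ord /dsum_wt; congr (_ + _)%N; apply: eq_bigr => i _.
  by rewrite (unsplitK (inl i)).
by rewrite (unsplitK (inr i)).
Qed.

Lemma wt_mult_sum n (wt : 'I_n -> int) mu : wt_mult wt mu = (\sum_i (wt i == mu))%N.
Proof.
rewrite /wt_mult -sum1_card big_mkcond; apply: eq_bigr => i _.
by rewrite inE; case: eqP.
Qed.

Lemma wt_mult_tens m n (u : 'I_m -> int) (w : 'I_n -> int) mu :
  wt_mult (tens_wt u w) mu = (\sum_i wt_mult w (mu - u i))%N.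
Proof.
under [RHS]eq_bigr do rewrite wt_mult_sum.
rewrite wt_mult_sum pair_big /= (reindex (@mxtens_index m n)) /=; last first.
  by exists (@mxtens_unindex m n) => i _; rewrite ?mxtens_indexK ?mxtens_unindexK.
apply: eq_bigr => -[i j] _; rewrite /tens_wt mxtens_indexK /=.
by congr (nat_of_bool _); apply/eqP/eqP; lia.
Qed.

(** The weights d-2, d-4, ..., -(d-2) and d-1, d-3, ..., -(d-1) of the two
    irreducibles of dimensions d-1 and d interleave into d-1, d-2, ..., -(d-1). *)
Lemma sum_odd_even (g : nat -> nat) e :
  (\sum_(0 <= i < e) g (2 * i).+1 + \sum_(0 <= i < e.+1) g (2 * i) =
   \sum_(0 <= i < (2 * e).+1) g i)%N.
Proof.
elim: e => [|e IH]; first by rewrite big_geq // muln0 !big_nat1 muln0.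
have -> : ((2 * e.+1).+1 = (2 * e).+3)%N by lia.
rewrite !(big_nat_recr (2 * e).+2) ?(big_nat_recr (2 * e).+1) //= -IH.
rewrite (big_nat_recr e) // [X in (_ + X)%N = _](big_nat_recr e.+1) //=.
have -> : (2 * e.+1 = (2 * e).+2)%N by lia.
lia.
Qed.
End WeightConstructions.

(** * Walks on the integers and the Motzkin triangle *)

(** The number of n-step walks from 0 to j with steps of size at most d - 1;
    these are the coefficients of (x^(-(d-1)) + ... + x^(d-1))^n. *)
Fixpoint walks (d : nat) (j : int) (n : nat) : nat :=
  if n is n'.+1 then
    (\sum_(i < (2 * d).-1) walks d (j - d.-1%:Z + i%:Z) n')%N
  else j == 0.

(** Both sides satisfy the same linear recurrence in n, and at n = 0 the
    difference of the indicator functions of k = 1 and k = -1 is the first row of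
    the triangle. *)
Lemma motzkin_walks d k n :
  motzkin d k n = (walks d (k - 1) n)%:Z - (walks d (k + 1) n)%:Z.
Proof.
elim: n k => [|n IH] k /=.
  by rewrite subr_eq0 addr_eq0; have [->|_] := eqVneq k (-1); case: (k == 1).
rewrite !(big_morph Posz PoszD (erefl _)) -sumrB; apply: eq_bigr => i _; rewrite IH.
by congr ((walks d _ n)%:Z - (walks d _ n)%:Z); lia.
Qed.

Lemma walksN d j n : (0 < d)%N -> walks d (- j) n = walks d j n.
Proof.
move=> d_gt0; elim: n j => [|n IH] j /=; first by rewrite oppr_eq0.
rewrite (reindex_inj rev_ord_inj); apply: eq_bigr => i _.
by rewrite -IH; congr walks; have := ltn_ord i; rewrite /=; lia.
Qed.

(** From j to j+1, with j >= 0, the window of summation loses the endpoint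
    j - (d-1) and gains j + d, which is farther from 0. *)
Lemma leq_walks d n (j l : int) :
  (0 < d)%N -> (`|j| <= `|l|)%N -> (walks d l n <= walks d j n)%N.
Proof.
move=> d_gt0; elim: n j l => [|n IH] j l jl /=.
  by case: eqP => // ?; case: eqP => //; lia.
have step (k : nat) : (walks d k.+1%:Z n.+1 <= walks d k%:Z n.+1)%N.
  rewrite /=; have -> : ((2 * d).-1 = (2 * d.-1).+1)%N by lia.
  rewrite big_ord_recr big_ord_recl /= [X in (_ <= X)%N]addnC.
  apply: leq_add; last first.
    by apply: IH; lia.
  by apply: leq_sum => i _; rewrite /bump /=; apply: IH; lia.
have mono (a b : nat) : (a <= b)%N -> (walks d b%:Z n.+1 <= walks d a%:Z n.+1)%N.
  by move=> /subnK <-; elim: (b - a)%N => // m; apply: leq_trans; apply: step.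
have abs (a : int) : walks d a n.+1 = walks d `|a|%N n.+1.
  by case: a => m //; rewrite NegzE walksN.
by have := mono _ _ jl; rewrite -!abs.
Qed.

(** The character of a tensor product is the product of the characters, and that
    of A (+) B is x^(-(d-1)) + ... + x^(d-1): tensoring once more is the
    recurrence that defines walks. *)
Lemma tens_pow_weighted (F : numClosedFieldType) (A B : rep F) d n :
  (2 <= d)%N -> irreducible A -> irreducible B -> rdim A = d.-1 -> rdim B = d ->
  exists2 wt, weighted (V := tens_pow (dsum A B) n) wt &
    forall mu, wt_mult wt mu = walks d mu n.
Proof.
move=> d_ge2 irrA irrB dimA dimB.
have wAB := weighted_dsum (weighted_irr irrA) (weighted_irr irrB).
elim: n => [|n [wt w_wt multE]].
  exists (fun=> 0); first exact: weighted_triv.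
  by move=> mu; rewrite wt_mult_sum big_ord1 /= eq_sym.
eexists; first exact: (weighted_tens wAB w_wt).
move=> mu; rewrite wt_mult_tens (sum_dsum_wt _ _ (fun j => wt_mult wt (mu - j))).
under eq_bigr do rewrite multE; under [X in (_ + X)%N]eq_bigr do rewrite multE.
pose g i := walks d (mu - d.-1%:Z + i%:Z) n.
transitivity (\sum_(0 <= i < d.-1) g (2 * i).+1 + \sum_(0 <= i < d.-1.+1) g (2 * i))%N.
  rewrite prednK ?dimA ?dimB; last by lia.
  rewrite !big_mkord; congr (_ + _)%N; apply: eq_bigr => i _.
    by congr walks; rewrite /irr_wt; lia.
  by congr walks; rewrite /irr_wt; lia.
rewrite sum_odd_even big_mkord /=.
by have -> : ((2 * d).-1 = (2 * d.-1).+1)%N by lia.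
Qed.

Theorem corollary4p4 (R : realType) (irr : nat -> rep R[i])
    (irrP : forall k : nat, (0 < k)%N -> rdim (irr k) = k /\ irreducible (irr k))
    (d : nat) (hd : (2 <= d)%N) (n : nat) :
  (forall k : nat, (0 < k)%N -> 0 <= motzkin d k%:Z n) /\
  exists N : nat,
    (forall k : nat, (N < k)%N -> motzkin d k%:Z n = 0) /\
    rep_iso (tens_pow (dsum (irr d.-1) (irr d)) n)
            (\big[@dsum R[i] / rep_zero R[i]]_(1 <= k < N.+1)
               copies `|motzkin d k%:Z n|%N (irr k)).
Proof.
have d_gt0 : (0 < d)%N by lia.
have walks_dec k : (walks d k.+2 n <= walks d k n)%N by apply: leq_walks => //; lia.
have motzkinE k : (0 < k)%N ->
    motzkin d k%:Z n = (walks d k.-1 n - walks d k.+1 n)%N.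
  case: k => // k _; rewrite motzkin_walks -subzn //.
  by congr ((walks d _ n)%:Z - (walks d _ n)%:Z); lia.
split=> [k k_gt0|]; first by rewrite motzkinE.
have [dimA irrA] : rdim (irr d.-1) = d.-1 /\ irreducible (irr d.-1).
  by apply: irrP; lia.
have [dimB irrB] := irrP d d_gt0.
have [wt w_wt multE] := tens_pow_weighted n hd irrA irrB dimA dimB.
have [] := @weighted_decomp _ _ wt irr irrP w_wt.
- by move=> mu; rewrite !multE walksN.
- by move=> k; rewrite !multE.
move=> N [mult0 iso]; exists N; split.
  move=> k Nk; rewrite motzkinE -?multE ?mult0 //; lia.
rewrite (eq_big_nat _ _ (F2 := fun k =>
  copies (wt_mult wt k.-1 - wt_mult wt k.+1) (irr k))) //.
by move=> k /andP[k_gt0 _]; rewrite motzkinE // !multE.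
Qed.
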